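(* Let $\rho>0$, let $T\in\mathrm{Lip}(\rho)$, $T:C\to C$, and let $x^0\in C$ with $x^0\ne Tx^0$. Consider the adaptive Halpern iteration: $\beta_0=0$, $R_0=1$, $\hat\kappa_0=\|x^0-Tx^0\|$, and for $n=1,2,\dots$ $$\beta_n=B_\rho(R_{n-1}),\quad x^n=(1-\beta_n)x^0+\beta_nTx^{n-1},\quad \hat\kappa_n=\max\{\hat\kappa_{n-1},\|x^0-Tx^n\|\},\quad R_n=1-\beta_n+\beta_n\frac{\|Tx^n-Tx^{n-1}\|}{\hat\kappa_n}.$$ Then for all $n\ge1$ we have $\beta_n\ge\beta_{n-1}$ and $r_\rho\le R_n\le V_\rho(R_{n-1})$, and the following error bound is satisfied: $$\|x^n-Tx^n\|\le\hat\kappa_nR_n\le\hat\kappa_nR_n^*,$$ where $R_0^*=1$ and $R_n^*=V_\rho(R_{n-1}^* )$ for $n\ge1$.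
   Context: For $\rho>0$, $\mathrm{Lip}(\rho)$ is the class of all maps $T:C\to C$, where $C$ is a nonempty convex subset (not necessarily bounded or closed) of an arbitrary real normed space $(X,\|\cdot\|)$ (not necessarily complete), such that $\|Tx-Ty\|\le\rho\|x-y\|$ for all $x,y\in C$. For $r\in[0,1]$ let $$V_\rho(r)=\min_{\beta\in[0,1]}1-\beta+\rho\beta^2+\rho\beta(r-1),\qquad B_\rho(r)=\min\{1,\tfrac12(1/\rho+1-r)\}$$ ($B_\rho(r)$ is the minimizer in $V_\rho(r)$), and let $r_\rho=\max\{0,1-1/\rho\}$. *)

(* Defs.v *)
From HB Require Import structures.
From mathcomp Require Import all_boot all_order all_algebra ring lra.
From mathcomp Require Import all_classical all_reals all_analysis.
Import Order.TTheory GRing.Theory Num.Theory.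
Import numFieldNormedType.Exports.

Set Implicit Arguments.
Unset Strict Implicit.
Unset Printing Implicit Defensive.

Local Open Scope classical_set_scope.
Local Open Scope ring_scope.

(* A map T : C -> C is represented by a total T : X -> X that sends C to C;
   its values outside C are unconstrained. *)
Definition Lip (R : realType) (X : normedModType R) (rho : R) (C : set X)
    (T : X -> X) : Prop :=
  [/\ C !=set0, convex_set C, set_fun C C T & rho.-lipschitz_C T].

Definition halpern_obj (R : realType) (rho r b : R) : R :=
  1 - b + rho * b ^+ 2 + rho * b * (r - 1).

(* The infimum is a minimum: see halpernVP. *)
Definition halpernV (R : realType) (rho r : R) : R :=
  inf [set halpern_obj rho r b | b in `[0, 1]].

Definition halpernB (R : realType) (rho r : R) : R :=
  Num.min 1 (2^-1 * (rho^-1 + 1 - r)).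

Definition halpern_r (R : realType) (rho : R) : R := Num.max 0 (1 - rho^-1).

Lemma halpernVP (R : realType) (rho r : R) : 0 < rho -> 0 <= r <= 1 ->
  [/\ halpernB rho r \in `[0, 1],
      halpernV rho r = halpern_obj rho r (halpernB rho r) &
      forall b, b \in `[0, 1] -> halpernV rho r <= halpern_obj rho r b].
Proof.
move=> rho0 /andP[r0 r1].
have i0 : 0 < rho^-1 by rewrite invr_gt0.
have ri : rho * rho^-1 = 1 by rewrite divff// gt_eqF.
have B01 : halpernB rho r \in `[0, 1].
  rewrite in_itv/= /halpernB ge_min lexx/= andbT le_min ler01/=; lra.
have minB b : b \in `[0, 1] ->
    halpern_obj rho r (halpernB rho r) <= halpern_obj rho r b.
  rewrite in_itv/= => /andP[b0 b1].
  pose m := 2^-1 * (rho^-1 + 1 - r).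
  have objE c : halpern_obj rho r c = 1 + rho * ((c - m) ^+ 2 - m ^+ 2).
    have -> : rho * ((c - m) ^+ 2 - m ^+ 2) =
        rho * c ^+ 2 - (rho * rho^-1) * c + rho * c * (r - 1) by rewrite /m; field; rewrite gt_eqF.
    rewrite ri /halpern_obj; ring.
  rewrite !objE lerD2l ler_pM2l// lerD2r /halpernB -/m.
  case: (leP 1 m) => m1; first by nra.
  by rewrite subrr expr0n/= sqr_ge0.
have VE : halpernV rho r = halpern_obj rho r (halpernB rho r).
  apply/eqP; rewrite eq_le; apply/andP; split.
    apply: ge_inf; last by exists (halpernB rho r).
    by exists (halpern_obj rho r (halpernB rho r)) => _ [b b01 <-]; exact: minB.
  apply: lb_le_inf; first by exists (halpern_obj rho r (halpernB rho r)), (halpernB rho r).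
  by move=> _ [b b01 <-]; exact: minB.
by split=> // b b01; rewrite VE minB.
Qed.

Record halpern_state (R : realType) (X : normedModType R) := HalpernState {
  hbeta : R;
  hx : X;
  hkappa : R;
  hR : R
}.

Definition halpern_init (R : realType) (X : normedModType R) (T : X -> X)
    (x0 : X) : halpern_state X :=
  HalpernState 0 x0 `|x0 - T x0| 1.

Definition halpern_step (R : realType) (X : normedModType R) (rho : R)
    (T : X -> X) (x0 : X) (s : halpern_state X) : halpern_state X :=
  let b := halpernB rho (hR s) in
  let x := (1 - b) *: x0 + b *: T (hx s) in
  let k := Num.max (hkappa s) `|x0 - T x| in
  HalpernState b x k (1 - b + b * (`|T x - T (hx s)| / k)).

Definition halpern (R : realType) (X : normedModType R) (rho : R)
    (T : X -> X) (x0 : X) (n : nat) : halpern_state X :=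
  iter n (halpern_step rho T x0) (halpern_init T x0).

Definition halpern_Rstar (R : realType) (rho : R) (n : nat) : R :=
  iter n (halpernV rho) 1.

(* Main.v *)
(* Since x^n and x^{n-1} are both of the form x^0 + beta (T y - x^0) and the
   parameters beta_n are nondecreasing, the triangle inequality gives
     |x^n - x^{n-1}| <= kappa_{n-1} (beta_n + R_{n-1} - 1).
   Applying T costs a factor rho, so R_n is at most the objective of
   V_rho(R_{n-1}) at its minimizer beta_n. As V_rho(r) <= r, the R_n are
   nonincreasing, and since B_rho is nonincreasing the beta_n remain
   nondecreasing, which closes the induction. Monotonicity of V_rho compares
   R_n with R_n^*. *)
Require Import Defs.
From HB Require Import structures.
From mathcomp Require Import all_boot all_order all_algebra.
From mathcomp Require Import all_classical all_reals all_analysis.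
From mathcomp Require Import ring lra.
Set Implicit Arguments.
Unset Strict Implicit.
Unset Printing Implicit Defensive.
Import Order.TTheory GRing.Theory Num.Theory.
Import numFieldNormedType.Exports.
Local Open Scope classical_set_scope.
Local Open Scope ring_scope.

(* The objective at 1 - r is exactly r. *)
Lemma halpernV_le_id (R : realType) (rho r : R) : 0 < rho -> 0 <= r <= 1 ->
  halpernV rho r <= r.
Proof.
move=> rho0 r01; have [_ _ Vmin] := halpernVP rho0 r01.
have /Vmin/le_trans : 1 - r \in `[0, 1] by rewrite in_itv/=; lra.
by apply; rewrite /halpern_obj le_eqVlt; apply/orP; left; apply/eqP; ring.
Qed.

(** For fixed [b >= 0] the objective is nondecreasing in [r]; comparing both objectives at the
    minimizer for [s] suffices. *)
Lemma halpernV_homo (R : realType) (rho r s : R) : 0 < rho ->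
  0 <= r -> r <= s -> s <= 1 -> halpernV rho r <= halpernV rho s.
Proof.
move=> rho0 r0 rs s1.
have [Bs -> _] := halpernVP (r := s) rho0 ltac:(lra).
have [_ _ /(_ _ Bs)/le_trans] := halpernVP (r := r) rho0 ltac:(lra).
apply; move: Bs; rewrite in_itv/= => /andP[B0 _].
by rewrite /halpern_obj lerD2l ler_wpM2l ?lerD2r// mulr_ge0// ltW.
Qed.

Lemma halpernB_anti (R : realType) (rho r s : R) : r <= s ->
  halpernB rho s <= halpernB rho r.
Proof.
move=> rs; rewrite /halpernB le_min !ge_min lexx/=.
by apply/orP; right; lra.
Qed.

Lemma halpern_r_ge0 (R : realType) (rho : R) : 0 <= halpern_r rho.
Proof. by rewrite le_max lexx. Qed.

(** Since [1 - r <= rho^-1], the bound on [b] gives [b <= rho^-1], hence [1 - b >= 1 - rho^-1]. *)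
Lemma halpern_r_le_step (R : realType) (rho b q r : R) : 0 <= b <= 1 -> 0 <= q ->
  halpern_r rho <= r -> b <= 2^-1 * (rho^-1 + 1 - r) ->
  halpern_r rho <= 1 - b + b * q.
Proof.
move=> /andP[b0 b1] q0; rewrite /halpern_r !ge_max => /andP[r0 rr] br.
have : 0 <= b * q by rewrite mulr_ge0.
by move=> bq0; apply/andP; split; lra.
Qed.

Lemma conv_dirE (R : pzRingType) (V : lmodType R) (b : R) (u v : V) :
  (1 - b) *: u + b *: v = u + b *: (v - u).
Proof. by rewrite scalerBl scale1r scalerBr addrAC addrA. Qed.

(** [inv_beta] is the monotonicity of beta one step ahead, which makes [inv_next] applicable to the
    next parameter. *)
Record halpern_inv (R : realType) (X : normedModType R) (rho : R)
    (C : set X) (T : X -> X) (x0 : X) (s : halpern_state X) : Prop := HalpernInv {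
  inv_mem : C (hx s);
  inv_kappa : 0 < hkappa s;
  inv_beta : hbeta s <= halpernB rho (hR s);
  inv_r : halpern_r rho <= hR s;
  inv_R : hR s <= 1;
  (* At b = halpernB rho (hR s) the convex combination is the next iterate. *)
  inv_next : forall b, hbeta s <= b ->
    `|(1 - b) *: x0 + b *: T (hx s) - hx s| <= hkappa s * (b + hR s - 1)
}.

Lemma halpern_init_inv (R : realType) (X : normedModType R) (rho : R)
    (C : set X) (T : X -> X) (x0 : X) : 0 < rho -> C x0 -> x0 <> T x0 ->
  halpern_inv rho C T x0 (halpern_init T x0).
Proof.
move=> rho0 Cx0 nfix; have i0 : 0 < rho^-1 by rewrite invr_gt0.
split=> //=.
- by rewrite normr_gt0 subr_eq0; apply/eqP.
- have [+ _ _] := halpernVP (r := 1) rho0 ltac:(lra).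
  by rewrite in_itv => /andP[].
- by rewrite /halpern_r ge_max; apply/andP; split; lra.
(* Here [hR] is 1 and the bound is an equality. *)
move=> b b0; rewrite addrK mulrC -[X in _ <= X * _](ger0_norm b0) -normrZ -normrN.
suff -> : - ((1 - b) *: x0 + b *: T x0 - x0) = b *: (x0 - T x0) by [].
by rewrite conv_dirE opprB opprD addrA subrr add0r -scalerN opprB.
Qed.

Lemma halpern_step_spec (R : realType) (X : normedModType R) (rho : R)
    (C : set X) (T : X -> X) (x0 : X) (s : halpern_state X) :
  0 < rho -> Lip rho C T -> C x0 -> halpern_inv rho C T x0 s ->
  let t := halpern_step rho T x0 s in
  [/\ halpern_inv rho C T x0 t, hbeta s <= hbeta t,
      hR t <= halpernV rho (hR s) &
      `|hx t - T (hx t)| <= hkappa t * hR t].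
Proof.
move=> rho0 [_ convC TC TL] Cx0 [Cs k0 Bs rR R1 Ns] /=.
have R01 : 0 <= hR s <= 1 by rewrite R1 andbT (le_trans (halpern_r_ge0 rho)).
have [+ VE _] := halpernVP rho0 R01.
set b := halpernB rho (hR s); rewrite in_itv/= => /andP[b0 b1].
set x := (1 - b) *: x0 + b *: T (hx s).
set k := Num.max (hkappa s) `|x0 - T x|.
set q := _ / k.
have sk : hkappa s <= k by rewrite le_max lexx.
have k0' : 0 < k by exact: lt_le_trans k0 sk.
have q0 : 0 <= q by rewrite divr_ge0// ltW.
have kq : k * q = `|T x - T (hx s)| by rewrite mulrC divfK// gt_eqF.
have Cx : C x.
  apply: set_mem; rewrite /x addrC.
  exact: (convC _ _ (Itv01 b0 b1) (mem_set (TC _ Cs)) (mem_set Cx0)).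
have Tx : `|T x - T (hx s)| <= rho * `|x - hx s| by exact: (TL (x, hx s)).
have Nx := Ns _ Bs; rewrite -/x in Nx.
have qle : q <= rho * (b + hR s - 1).
  (* The left side of [Nx] is a norm, so this factor is nonnegative and [hkappa s] may be enlarged
     to [k]. *)
  have p0 : 0 <= b + hR s - 1.
    by rewrite -(pmulr_rge0 _ k0); apply: le_trans Nx.
  rewrite -(ler_pM2l k0') kq (le_trans Tx)// mulrCA ler_pM2l//.
  by rewrite (le_trans Nx)// ler_wpM2r.
have RV : 1 - b + b * q <= halpernV rho (hR s).
  rewrite VE -/b /halpern_obj.
  (* Multiplying [qle] by [b] produces exactly the last two terms of the objective at [b]. *)
  have := ler_wpM2l b0 qle; lra.
have RR : 1 - b + b * q <= hR s by apply: le_trans RV (halpernV_le_id rho0 R01).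
have bm : b <= 2^-1 * (rho^-1 + 1 - hR s) by rewrite /b /halpernB ge_min lexx orbT.
(* The two differences have norms at most [k] and equal to [k * q], so the residual is at most
   [k * (1 - b + b * q)]. *)
have xT : x - T x = (1 - b) *: (x0 - T x) + b *: (T (hx s) - T x).
  by rewrite !scalerBr addrACA -opprD -scalerDl subrK scale1r.
have Dx : `|x0 - T x| <= k by rewrite le_max lexx orbT.
split=> //.
  split=> //=.
  - exact: halpernB_anti.
  - by apply: (@halpern_r_le_step _ _ _ _ (hR s)) => //; rewrite b0.
  - exact: le_trans RR R1.
  move=> c bc; rewrite -/b -/x -/k -/q.
  (* As [c >= b], the triangle inequality gives [k * (c - b + b * q)], which is the required bound
     for the new [hR]. *)
  have -> : (1 - c) *: x0 + c *: T x - x =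
      (c - b) *: (T x - x0) + b *: (T x - T (hx s)).
    rewrite conv_dirE [X in _ - X = _]conv_dirE opprD addrACA subrr add0r scalerBl.
    by rewrite -addrA -!scalerN !opprB -scalerDr subrKA.
  rewrite (le_trans (ler_normD _ _))// !normrZ ger0_norm ?subr_ge0//
    (ger0_norm b0) -kq.
  rewrite (distrC (T x) x0).
  have := ler_wpM2l (_ : 0 <= c - b) Dx.
  rewrite subr_ge0 => /(_ bc); lra.
rewrite -/b -/x -/k -/q xT (le_trans (ler_normD _ _))// !normrZ
  ger0_norm ?subr_ge0// (ger0_norm b0).
rewrite (distrC (T _)) -kq.
have := ler_wpM2l (_ : 0 <= 1 - b) Dx.
rewrite subr_ge0 => /(_ b1); lra.
Qed.

Theorem theorem5 (R : realType) (X : normedModType R) (rho : R)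
  (C : set X) (T : X -> X) (x0 : X)
  (rho_gt0 : 0 < rho) (T_Lip : Lip rho C T) (x0_C : C x0) (x0_nfix : x0 <> T x0) :
  let beta n := hbeta (halpern rho T x0 n) in
  let x n := hx (halpern rho T x0 n) in
  let kappa n := hkappa (halpern rho T x0 n) in
  let Res n := hR (halpern rho T x0 n) in
  let Rstar n := halpern_Rstar rho n in
  forall n : nat, (1 <= n)%N ->
    [/\ beta n >= beta n.-1,
        halpern_r rho <= Res n,
        Res n <= halpernV rho (Res n.-1),
        `|x n - T (x n)| <= kappa n * Res n &
        kappa n * Res n <= kappa n * Rstar n].
Proof.
move=> beta x kappa Res Rstar.
have inv n : halpern_inv rho C T x0 (halpern rho T x0 n).
  elim: n => [|n IHn]; first exact: halpern_init_inv.
  by case: (halpern_step_spec rho_gt0 T_Lip x0_C IHn).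
have step n := halpern_step_spec rho_gt0 T_Lip x0_C (inv n).
have Res_ge0 n : 0 <= Res n by exact: le_trans (halpern_r_ge0 rho) (inv_r (inv n)).
(* The bound by 1 is carried along because [halpernV_homo] compares arguments in [0, 1] only. *)
have Res_le n : Res n <= Rstar n <= 1.
  elim: n => [|n /andP[IHn Rn1]]; first by rewrite /Res /Rstar/= lexx.
  have Rn0 : 0 <= Rstar n by exact: le_trans IHn.
  have [_ _ RV _] := step n.
  apply/andP; split.
    exact: le_trans RV (halpernV_homo rho_gt0 (Res_ge0 n) IHn Rn1).
  have R01 : 0 <= Rstar n <= 1 by rewrite Rn0.
  exact: le_trans (halpernV_le_id rho_gt0 R01) Rn1.
case=> // n _; have [invS bS RV err] := step n.
split=> //; first exact: inv_r invS.
rewrite ler_pM2l ?(inv_kappa invS)//.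
by case/andP: (Res_le n.+1).
Qed.
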